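(* For all $(n,p)\in\mathbb{N}^2$ with $n\ge p$, we have $Sr(n,p)=T(n+1,p+1)$.
   Context: $\mathbb{N}=\{1,2,3,\dots\}$ and $[n]=\{1,2,\dots,n\}$. For $(n,p)\in\mathbb{N}^2$, define $$Sr(n,p)=\left|\{F\subset[n] : F\neq\emptyset,\ p\min F\ge |F| \text{ and } F \text{ is an interval (a set of consecutive integers)}\}\right|.$$ For integers $N\ge 1$ and $r\ge 1$, the Turán graph on $N$ vertices with $r$ parts is the complete $r$-partite graph on $N$ vertices whose parts differ in size by at most $1$ (two vertices are adjacent if and only if they lie in different parts); $T(N,r)$ denotes the number of edges of this graph. *)

(* Defs.v *)
From mathcomp Require Import all_boot.

Set Implicit Arguments.
Unset Strict Implicit.
Unset Printing Implicit Defensive.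

(* The ambient type 'I_n.+1 is {0, ..., n}, so that ordinals keep their value
   and [n] = {1, ..., n} is the subset of the nonzero ones. *)
Definition bracket (n : nat) : {set 'I_n.+1} := [set i : 'I_n.+1 | 0 < i].

(* For a nonempty F the default value n is never smaller than the minimum. *)
Definition set_min (n : nat) (F : {set 'I_n.+1}) : nat :=
  \big[minn/n]_(i in F) (i : nat).

Definition is_interval (n : nat) (F : {set 'I_n.+1}) : bool :=
  [exists a : 'I_n.+1, exists b : 'I_n.+1,
     F == [set i : 'I_n.+1 | a <= i <= b]].

Definition Sr (n p : nat) : nat :=
  #|[set F : {set 'I_n.+1} |
      [&& F \subset bracket n, F != set0, #|F| <= p * set_min F
        & is_interval F]]|.

Definition edge_set (V : finType) (e : rel V) : {set {set V}} :=
  [set A | [exists x, exists y, e x y && (A == [set x; y])]].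

Definition part (V : finType) (r : nat) (c : V -> 'I_r) (k : 'I_r) : {set V} :=
  [set x | c x == k].

(* The r parts are the fibres of c. *)
Definition is_turan_graph (V : finType) (r : nat) (e : rel V) : Prop :=
  exists c : V -> 'I_r,
    (forall x y, e x y = (c x != c y)) /\
    (forall k l : 'I_r, #|part c k| <= #|part c l| + 1).

(* The parts are the residue classes modulo r; turan_graphP and
   turan_graph_edges below show that this is a Turan graph and that every
   Turan graph with N vertices and r parts has the same number of edges. *)
Definition turan_graph (N r : nat) : rel 'I_N :=
  fun i j => i %% r != j %% r.

Definition T (N r : nat) : nat := #|edge_set (@turan_graph N r)|.

Lemma card_residue (N r k : nat) : k < r ->
  #|[set i : 'I_N | i %% r == k]| = N %/ r + (k < N %% r).
Proof.
move=> ltkr; have r0 : 0 < r by apply: leq_ltn_trans ltkr.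
rewrite cardsE -sum1_card -(big_mkord (fun i => i %% r == k) (fun=> 1)).
rewrite {1}(divn_eq N r); move: (ltn_pmod N r0); move: (N %% r) (N %/ r).
have base m : m <= r -> \sum_(0 <= i < m | i %% r == k) 1 = (k < m).
  elim: m => [|m IH] lemr; first by rewrite big_geq.
  rewrite big_mkcond big_nat_recr //= -big_mkcond IH ?(ltnW lemr) //.
  rewrite modn_small // ltnS [k <= m]leq_eqVlt eq_sym.
  by case: eqP => [->|_]; rewrite ?ltnn // addn0.
move=> s q; elim: q => [|q IH] ltsr; first by rewrite mul0n base // ltnW.
rewrite mulSn -addnA (big_cat_nat (leq0n r) (leq_addr (q * r + s) r)) /=.
rewrite base // ltkr -{1}[r]add0n big_addn addKn.
under eq_bigl do rewrite modnDr.
by rewrite IH // addnA.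
Qed.

Lemma turan_graphP (N r : nat) : 0 < r -> is_turan_graph r (@turan_graph N r).
Proof.
move=> r0; exists (fun i : 'I_N => Ordinal (ltn_pmod i r0)); split=> // k l.
have cardp (m : 'I_r) :
    #|part (fun i : 'I_N => Ordinal (ltn_pmod i r0)) m|
      = N %/ r + (m < N %% r) by rewrite -card_residue.
by rewrite !cardp -addnA leq_add2l; case: (k < _); case: (l < _).
Qed.

Lemma card_edge_set (V : finType) (e : rel V) :
  symmetric e -> irreflexive e ->
  #|[set z : V * V | e z.1 z.2]| = (#|edge_set e|).*2.
Proof.
move=> eS eI; pose h (z : V * V) := [set z.1; z.2].
rewrite -muln2 -sum_nat_const -sum1_card.
rewrite (partition_big h [in edge_set e]) /=; last first.
  move=> [x y]; rewrite !inE /= => exy.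
  by apply/existsP; exists x; apply/existsP; exists y; rewrite exy /=.
apply: eq_bigr => A; rewrite inE => /existsP[x /existsP[y /andP[exy /eqP->]]].
have nxy : x != y by apply: contraTneq exy => ->; rewrite eI.
rewrite sum1_card.
have -> : 2 = #|[set (x, y); (y, x)]|.
  by rewrite cards2 xpair_eqE (negPf nxy).
apply: eq_card => -[u v]; rewrite !inE unfold_in /= inE /=.
apply/andP/orP => [[euv /eqP E]|]; last first.
  case=> /eqP[-> ->]; first by [].
  by rewrite eS exy /h /= setUC.
have nuv : u != v by apply: contraTneq euv => ->; rewrite eI.
have := set21 u v; have := set22 u v.
rewrite -[[set u; v]]/(h (u, v)) E !inE !xpair_eqE.
case/orP=> /eqP ? /orP[] /eqP ?; subst; rewrite ?eqxx ?orbT //.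
all: by rewrite ?eqxx in nuv *; auto.
Qed.

Section TuranCount.

Variables (V : finType) (r : nat) (c : V -> 'I_r).
Hypothesis balanced : forall k l : 'I_r, #|part c k| <= #|part c l| + 1.

Let q := #|V| %/ r.

Lemma sum_part : \sum_k #|part c k| = #|V|.
Proof.
rewrite -[RHS]sum1_card (partition_big c xpredT) //=.
by apply: eq_bigr => k _; rewrite -sum1_card; apply: eq_bigl => x; rewrite inE.
Qed.

Lemma balanced_part k : #|part c k| = q \/ #|part c k| = q.+1.
Proof.
have r0 : 0 < r by apply: leq_ltn_trans (ltn_ord k).
have leqN : r * q <= #|V| by rewrite mulnC leq_divM.
have ltNq : #|V| < r * q.+1 by rewrite mulnC ltn_ceil.
have lo : q <= #|part c k|.
  rewrite leqNgt; apply/negP => ltkq.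
  have: \sum_l #|part c l| < \sum_(l < r) q.
    rewrite (bigD1 k) //= [ltnRHS](bigD1 k) //= -addSn leq_add //.
    by apply: leq_sum => l _; apply: leq_trans (balanced l k) _; rewrite addn1.
  by rewrite sum_part sum_nat_const card_ord ltnNge leqN.
have hi : #|part c k| <= q.+1.
  rewrite leqNgt; apply/negP => ltqk.
  have: \sum_(l < r) q.+1 <= \sum_l #|part c l|.
    apply: leq_sum => l _; rewrite -ltnS.
    by apply: leq_trans ltqk _; rewrite -addn1.
  by rewrite sum_part sum_nat_const card_ord leqNgt ltNq.
by move: lo hi; rewrite leq_eqVlt => /orP[/eqP<-|lo hi];
  [left | right; apply/eqP; rewrite eqn_leq hi].
Qed.

Lemma card_nonadjacent :
  #|[set z : V * V | c z.1 == c z.2]| = \sum_k #|part c k| ^ 2.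
Proof.
rewrite -sum1_card (partition_big (fun z => c z.1) xpredT) //=.
apply: eq_bigr => k _; rewrite -mulnn -cardsX -sum1_card.
apply: eq_bigl => -[x y]; rewrite !inE /=.
by apply/andP/andP => -[/eqP a /eqP b]; rewrite ?a ?b ?eqxx // -b a.
Qed.

Lemma sum_sq_part :
  \sum_k #|part c k| ^ 2 + r * (q * q.+1) = q.*2.+1 * #|V|.
Proof.
have -> : r * (q * q.+1) = \sum_(k < r) q * q.+1.
  by rewrite sum_nat_const card_ord.
rewrite -sum_part big_distrr -big_split /=.
apply: eq_bigr => k _; rewrite -mulnn -addnn.
case: (balanced_part k) => ->; first by rewrite -mulnDr addnS mulnC.
by rewrite -mulnDl addSn.
Qed.

End TuranCount.

Lemma turan_graph_edges (V : finType) (r : nat) (e : rel V) :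
  is_turan_graph r e -> #|edge_set e| = T #|V| r.
Proof.
have count (W : finType) (f : rel W) : is_turan_graph r f ->
    (#|edge_set f|).*2 + #|W| %/ r * 2 * #|W| + #|W|
      = #|W| * #|W| + r * (#|W| %/ r * (#|W| %/ r).+1).
  case=> c [fE bal]; rewrite -card_edge_set; first last.
  - by move=> x; rewrite fE eqxx.
  - by move=> x y; rewrite !fE eq_sym.
  rewrite -addnA [_ * 2 * _ + _]addnC -mulSn muln2 -(sum_sq_part bal).
  rewrite -card_nonadjacent addnA -card_prod; congr (_ + _).
  rewrite -(cardC [in [set z : W * W | c z.1 == c z.2]]) addnC; congr (_ + _).
  by apply: eq_card => z; rewrite !inE fE.
move=> te; apply: double_inj.
have [r0|] := posnP r; last first.
  move=> r0; have := count _ _ (turan_graphP #|V| r0).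
  by rewrite card_ord -(count _ _ te) => /addIn/addIn.
case: te => c _; rewrite /T; congr _.*2.
have V0 (x : V) : False by case: (c x) => m; rewrite r0.
have E0 (W : finType) (f : rel W) : (W -> False) -> #|edge_set f| = 0.
  by move=> W0; apply: eq_card0 => A; rewrite inE; apply/existsP => -[x]; case: (W0 x).
by rewrite !E0 // => x; apply: V0 (enum_val x).
Qed.

(* Main.v *)
Require Import Defs.
From mathcomp Require Import all_boot.

(** Both numbers equal [\sum_(b <= n) (b - b %/ (p + 1))]. An interval [[a, b]]
    is counted by [Sr] iff [b %/ (p + 1) < a <= b], since
    [b - a + 1 <= p * a] means [b < (p + 1) * a]. An edge of the Turan graph
    whose larger endpoint is [b] has its smaller endpoint among the [b]
    numbers below [b], minus the [b %/ (p + 1)] ones congruent to [b]. *)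

(** Moving the count to ['I_b] makes the numbers below [b] the whole type, so [cardsC] can then
    count a complement among them. *)
Lemma card_ord_lt (N b : nat) (P : pred nat) : b <= N ->
  #|[set i : 'I_N | (i < b) && P i]| = #|[set i : 'I_b | P i]|.
Proof.
move=> lebN; rewrite !cardsE -!sum1_card.
rewrite [RHS](big_ord_widen_cond N P (fun=> 1)) //.
by apply: eq_bigl => i; rewrite unfold_in andbC.
Qed.

(** The case [a = b.+1] is the empty interval; it arises in [Sr_sum] at [b = 0]. *)
Lemma card_ord_interval (N a b : nat) : a <= b.+1 -> b < N ->
  #|[set i : 'I_N | a <= i <= b]| = b.+1 - a.
Proof.
move=> leab ltbN.
have -> : [set i : 'I_N | a <= i <= b] = [set i : 'I_N | (i < b.+1) && (a <= i)].
  by apply/setP=> i; rewrite !inE ltnS andbC.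
rewrite (card_ord_lt _ _ (leq a)) //.
have := cardsC [set i : 'I_b.+1 | a <= i].
have -> : ~: [set i : 'I_b.+1 | a <= i] = [set i : 'I_b.+1 | (i < a) && true].
  by apply/setP=> i; rewrite !inE ltnNge andbT.
rewrite (card_ord_lt _ _ xpredT) // cardsT !card_ord.
exact: (canRL (addnK a)).
Qed.

Lemma card_pair_set (A B : finType) (R : A -> B -> bool) :
  #|[set z : A * B | R z.1 z.2]| = \sum_b #|[set a | R a b]|.
Proof.
rewrite -sum1_card (partition_big snd xpredT) //=.
apply: eq_bigr => b _; rewrite sum1_card.
have pairI : injective (fun a : A => (a, b)) by move=> ? ? [].
rewrite -(card_imset _ pairI).
apply: eq_card => -[x y]; rewrite unfold_in /= !inE /=.
apply/andP/imsetP => [[Rxy /eqP <-]|[a]]; first by exists x; rewrite ?inE.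
by rewrite inE => Rab [-> ->].
Qed.

Lemma set_min_eq (n : nat) (F : {set 'I_n.+1}) (a : 'I_n.+1) :
  a \in F -> {in F, forall i : 'I_n.+1, a <= i} -> set_min F = a.
Proof.
move=> aF amin; apply/eqP; rewrite eqn_leq; apply/andP; split.
  (* Upper bound: walk along the enumeration until [a] is met; from there on the running minimum is
     at most [a]. *)
  rewrite /set_min; have := mem_index_enum a.
  elim: (index_enum _) => // x s IH; rewrite in_cons big_cons.
  case/orP=> [/eqP <-|/IH les]; first by rewrite aF geq_minl.
  by case: ifP => // _; rewrite geq_min les orbT.
rewrite /set_min; elim/big_ind: _ => [|x y lex ley|i /amin //].
  (* The default value: [a <= n] since [a] lies in ['I_n.+1]. *)
  by rewrite -ltnS.
by rewrite leq_min lex.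
Qed.

Lemma Sr_sum (n p : nat) : Sr n p = \sum_(b < n.+1) (b - b %/ p.+1).
Proof.
pose itv (z : 'I_n.+1 * 'I_n.+1) := [set i : 'I_n.+1 | z.1 <= i <= z.2].
pose R (a b : 'I_n.+1) := b %/ p.+1 < a <= b.
have minE (a b : 'I_n.+1) : a <= b -> set_min (itv (a, b)) = a.
  by move=> ab; apply: set_min_eq => [|i]; rewrite !inE ?leqnn //= => /andP[].
have cardE (a b : 'I_n.+1) : a <= b -> #|itv (a, b)| = b.+1 - a.
  by move=> ab; rewrite card_ord_interval //= ltnW.
(* A nonempty interval determines its left end as its minimum, and then its right end through its
   cardinality. *)
have itv_inj : {in [set z | R z.1 z.2] &, injective itv}.
  move=> [a b] [c d]; rewrite !inE /= => /andP[_ ab] /andP[_ cd] E.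
  have ac : a = c :> nat by rewrite -(minE _ _ ab) E minE.
  have := cardE _ _ ab; rewrite E cardE // ac => /eqP.
  rewrite eqn_sub2rE ?leqW -?ac ?(leq_trans _ ab) // ?ac // eqSS => /eqP db.
  by congr pair; apply: val_inj.
have -> : Sr n p = #|itv @: [set z | R z.1 z.2]|.
  apply: eq_card => F; rewrite inE.
  apply/and4P/imsetP => [[F0 Fn Fp /existsP[a /existsP[b /eqP FE]]]|[[a b]]].
    (* Reversed endpoints would give the empty set. *)
    have ab : a <= b.
      by case/set0Pn: Fn => i; rewrite FE inE => /andP[]; apply: leq_trans.
    exists (a, b); rewrite // inE /R /= ab andbT ltn_divLR //.
    move: Fp; rewrite FE -/(itv (a, b)) cardE // minE // leq_subLR.
    by rewrite -mulSn mulnC.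
  rewrite inE /= => /andP[ba ab] ->; split.
  (* The strict bound [b %/ p.+1 < a] forces [a > 0], so the interval avoids 0. *)
  - apply/subsetP=> i; rewrite !inE /= => /andP[ai _].
    by apply: leq_trans ai; apply: leq_ltn_trans ba.
  - by apply/set0Pn; exists a; rewrite inE /= leqnn.
  - by rewrite cardE // minE // leq_subLR -mulSn mulnC -ltn_divLR.
  - by apply/existsP; exists a; apply/existsP; exists b.
rewrite card_in_imset // card_pair_set; apply: eq_bigr => b _.
by rewrite /R card_ord_interval ?subSS // ltnS leq_div.
Qed.

Lemma T_sum (N r : nat) : 0 < r -> T N r = \sum_(b < N) (b - b %/ r).
Proof.
move=> r0; pose R (a b : 'I_N) := (a < b) && (a %% r != b %% r).
pose edge (z : 'I_N * 'I_N) := [set z.1; z.2].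
(* Orienting edges by [a < b] leaves one ordered pair per edge: any other matching of the endpoints
   contradicts [a < b] or [c < d]. *)
have edge_inj : {in [set z | R z.1 z.2] &, injective edge}.
  move=> [a b] [c d]; rewrite !inE /= => /andP[ab _] /andP[cd _] E.
  have := set21 a b; have := set22 a b.
  rewrite -[[set a; b]]/(edge (a, b)) E !inE /=.
  case/orP=> /eqP ? /orP[] /eqP ?; subst => //.
  - by rewrite ltnn in ab.
  - by move: (ltn_trans ab cd); rewrite ltnn.
  - by rewrite ltnn in ab.
have -> : T N r = #|edge @: [set z | R z.1 z.2]|.
  apply: eq_card => A; rewrite inE.
  apply/existsP/imsetP => [[x /existsP[y /andP[exy /eqP ->]]]|[[a b]]].
    case: (ltngtP x y) => xy.
    - by exists (x, y); rewrite // inE /R /= xy.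
    - by exists (y, x); rewrite /edge /= 1?setUC // inE /R /= xy eq_sym.
    - by move: exy; rewrite /turan_graph xy eqxx.
  rewrite inE /= => /andP[_ eab] ->.
  by exists a; apply/existsP; exists b; rewrite /turan_graph eab /=.
rewrite card_in_imset // card_pair_set; apply: eq_bigr => b _.
rewrite /R (card_ord_lt _ _ (fun a => a %% r != b %% r)) ?(ltnW (ltn_ord b)) //.
(* In [card_residue] with [N = b] and [k = b %% r] the correction term is [b %% r < b %% r], hence
   0: exactly [b %/ r] smaller numbers are congruent to [b]. *)
have := cardsC [set i : 'I_b | i %% r == b %% r].
rewrite card_residue ?ltn_pmod // ltnn addn0 card_ord.
by move/(canRL (addKn _)) <-; apply: eq_card => i; rewrite !inE.
Qed.

Theorem theorem1p2 (n p : nat) (hn : 1 <= n) (hp : 1 <= p) (hnp : p <= n) :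
  Sr n p = T (n + 1) (p + 1).
Proof. by rewrite !addn1 Sr_sum T_sum. Qed.
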